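(* Let $r\ge1$, $\mathbf n=(n_1,\dots,n_r)\in\mathbb N_0^r$ with $n_1\ge1$, $\mathbf a,\mathbf b\in\mathbb R^{r+1}$, $\mathbf x\in\mathbb C^r$, such that no lower parameter of the ${}_3F_2$'s occurring below is a nonpositive integer. Then $$E_0\;{}_rS_{\mathbf n}(\mathbf x;\mathbf a,\mathbf b)+E_1\;{}_rS_{n_1+1,n_2,\dots,n_r}(\mathbf x;\mathbf a,b_1-1,b_2,\dots,b_{r+1})+E_2\;{}_rS_{n_1+2,n_2,\dots,n_r}(\mathbf x;\mathbf a,b_1-2,b_2,\dots,b_{r+1})=0,$$ where $$E_0=\frac{b_1-1+\frac{x_1}{2}}{n_1},$$ $$E_1=\frac{\big(2|\mathbf n^2|+|\mathbf a^2|+|\mathbf b^2|\big)\big(|\mathbf n^2|+|\mathbf a|\big)-\big(n_1+2|\mathbf n^2|+|\mathbf a|+|\mathbf b|-1\big)\big(|\mathbf n^2|+|\mathbf a^2|+\frac{x_1}{2}\big)}{(n_1)_2}+\frac{n_1+3|\mathbf n^2|+a_1+2|\mathbf a^2|-b_1+|\mathbf b^2|+2-\frac{x_1}{2}}{n_1},$$ $$E_2=-\frac{\big(n_1+2|\mathbf n^2|+|\mathbf a^2|+|\mathbf b^2|+1\big)\big(|\mathbf n|+|\mathbf a|+1\big)}{(n_1)_2}.$$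
   Context: Notation: $(c)_k=c(c+1)\cdots(c+k-1)$, $(c)_0=1$; ${}_3F_2\left(\begin{matrix}c_1,c_2,c_3\\ d_1,d_2\end{matrix}\Big|z\right)=\sum_{k\ge0}\frac{(c_1)_k(c_2)_k(c_3)_k}{(d_1)_k(d_2)_k}\frac{z^k}{k!}$ (a finite sum when $c_1=-n$, $n\in\mathbb N_0=\{0,1,\dots\}$). For $r\ge1$, $\mathbf n=(n_1,\dots,n_r)$, $\mathbf a=(a_1,\dots,a_{r+1})$, $\mathbf b=(b_1,\dots,b_{r+1})$: $|\mathbf n^j|=n_j+\cdots+n_r$ with $|\mathbf n^{r+1}|=0$, $|\mathbf a^j|=a_j+\cdots+a_{r+1}$, $|\mathbf b^j|=b_j+\cdots+b_{r+1}$, and $|\mathbf n|=|\mathbf n^1|$, $|\mathbf a|=|\mathbf a^1|$, $|\mathbf b|=|\mathbf b^1|$. For $\mathbf x=(x_1,\dots,x_r)$, $${}_rS_{\mathbf n}(\mathbf x;\mathbf a,\mathbf b)=\prod_{j=1}^r\left\{\Big(|\mathbf a^{j+1}|+\frac{x_j}{2}\Big)_{|\mathbf n^{j+1}|}\;{}_3F_2\left(\begin{matrix}-n_j,\;n_j+2|\mathbf n^{j+1}|+|\mathbf a^j|+|\mathbf b^j|-1,\;|\mathbf n^{j+1}|+|\mathbf a^{j+1}|+\frac{x_j}{2}\\ 2|\mathbf n^{j+1}|+|\mathbf a^{j+1}|+|\mathbf b^{j+1}|,\;|\mathbf n^{j+1}|+|\mathbf a^j|\end{matrix}\,\Big|\,1\right)\right\}.$$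 *)

(* Defs.v *)
From HB Require Import structures.
From mathcomp Require Import all_boot all_order all_algebra.
From mathcomp Require Import all_classical all_reals all_analysis.
From mathcomp Require Export complex.
Set Implicit Arguments.
Unset Strict Implicit.
Unset Printing Implicit Defensive.
Import Order.TTheory GRing.Theory Num.Theory.
Import numFieldNormedType.Exports.
Local Open Scope ring_scope.
Local Open Scope complex_scope.

Definition pochhammer (K : nzRingType) (c : K) (k : nat) : K :=
  \prod_(i < k) (c + i%:R).

(* The sum is the limit of the partial sums in K, so it has no meaning when
   the series diverges. *)
Definition hyp3F2 (K : numFieldType) (c1 c2 c3 d1 d2 z : K) : K :=
  limn (series (fun k : nat =>
    pochhammer c1 k * pochhammer c2 k * pochhammer c3 k
      / (pochhammer d1 k * pochhammer d2 k) * (z ^+ k / (k`!)%:R))).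

Definition nonpos_integer (R : realType) (d : R) : Prop :=
  exists m : nat, d = - m%:R.

(* Components are numbered from 0: with j the 0-based index, [tail v j] is
   |v^{j+1}| in the 1-based notation, so [tail v 0] is |v|, and [tail v j] is
   an empty sum when j is the length of v. *)
Definition tail (V : nmodType) (m : nat) (v : 'I_m -> V) (j : nat) : V :=
  \sum_(i < m | (j <= i)%N) v i.

Section MultivariateS.
Variables (R : realType) (r : nat).
Implicit Types (n : 'I_r -> nat) (a b : 'I_r.+1 -> R) (x : 'I_r -> R[i]).

Definition lower1 n a b (j : 'I_r) : R :=
  2 * (tail n j.+1)%:R + tail a j.+1 + tail b j.+1.

Definition lower2 n a (j : 'I_r) : R := (tail n j.+1)%:R + tail a j.

Definition admissible n a b : Prop :=
  forall j : 'I_r,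
    ~ nonpos_integer (lower1 n a b j) /\ ~ nonpos_integer (lower2 n a j).

Definition multiS n x a b : R[i] :=
  \prod_(j < r)
    (pochhammer ((tail a j.+1)%:C + x j / 2) (tail n j.+1) *
     hyp3F2 (- (n j)%:R)
            ((n j)%:R + 2 * (tail n j.+1)%:R
               + (tail a j)%:C + (tail b j)%:C - 1)
            ((tail n j.+1)%:R + (tail a j.+1)%:C + x j / 2)
            (lower1 n a b j)%:C
            (lower2 n a j)%:C
            1).

End MultivariateS.

Definition add_at (V : nmodType) (m : nat) (v : 'I_m -> V) (i : 'I_m) (t : V) :
    'I_m -> V :=
  fun j => if j == i then v j + t else v j.

Section Coefficients.
Variables (R : realType) (r : nat) (r_gt0 : (0 < r)%N).
Variables (n : 'I_r -> nat) (x : 'I_r -> R[i]) (a b : 'I_r.+1 -> R).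

Let n1 : R[i] := (n (Ordinal r_gt0))%:R.
Let x1 : R[i] := x (Ordinal r_gt0).
Let a1 : R[i] := (a ord0)%:C.
Let b1 : R[i] := (b ord0)%:C.
Let N : R[i] := (tail n 0)%:R.
Let A : R[i] := (tail a 0)%:C.
Let B : R[i] := (tail b 0)%:C.
Let N2 : R[i] := (tail n 1)%:R.
Let A2 : R[i] := (tail a 1)%:C.
Let B2 : R[i] := (tail b 1)%:C.

Definition E0 : R[i] := (b1 - 1 + x1 / 2) / n1.

Definition E1 : R[i] :=
  ((2 * N2 + A2 + B2) * (N2 + A)
     - (n1 + 2 * N2 + A + B - 1) * (N2 + A2 + x1 / 2)) / pochhammer n1 2
  + (n1 + 3 * N2 + a1 + 2 * A2 - b1 + B2 + 2 - x1 / 2) / n1.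

Definition E2 : R[i] :=
  - ((n1 + 2 * N2 + A2 + B2 + 1) * (N + A + 1) / pochhammer n1 2).

End Coefficients.

(* Main.v *)
(** In the three multivariate functions only the factor [j = 0] changes, and
    there the parameter [n_1 + 2|n^2| + |a| + |b| - 1] is invariant under
    [(n_1, b_1) -> (n_1 + 1, b_1 - 1)].  The statement is thus the three-term
    contiguous relation of a terminating 3F2(1) in one upper parameter [- n],
    proved by creative telescoping: with
    [t_k = (c2)_k (c3)_k / ((d1)_k (d2)_k k!)], the summand of [n (n + 1)] times the
    combination is [G_(k+1) - G_k] for
    [G_k = k (d1 + k - 1) (d2 + k - 1) t_k (- n - 2)_k / (n + 2)]. *)
Require Import Defs.
From mathcomp Require Import all_boot all_order all_algebra.
From mathcomp Require Import all_classical all_reals all_analysis.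
From mathcomp Require Import ring.
Import Order.TTheory GRing.Theory Num.Theory.
Import numFieldNormedType.Exports.
Local Open Scope ring_scope.
Local Open Scope complex_scope.

Lemma pochhammerS (K : nzRingType) (c : K) (k : nat) :
  pochhammer c k.+1 = pochhammer c k * (c + k%:R).
Proof. by rewrite /pochhammer big_ord_recr. Qed.

Lemma pochhammerSl (K : nzRingType) (c : K) (k : nat) :
  pochhammer c k.+1 = c * pochhammer (c + 1) k.
Proof.
rewrite /pochhammer big_ord_recl addr0; congr (_ * _).
by apply: eq_bigr => i _; rewrite -addrA nat1r lift0.
Qed.

(** Both sides are $(c-1)_{k+1}$, with either its first or its last factor split off. *)
Lemma pochhammer_subr1 (K : comNzRingType) (c : K) (k : nat) :
  (c - 1) * pochhammer c k = pochhammer (c - 1) k * (c - 1 + k%:R).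
Proof. by rewrite -pochhammerS pochhammerSl subrK. Qed.

Lemma pochhammerN_eq0 (K : nzRingType) (n k : nat) :
  (n < k)%N -> pochhammer (- n%:R : K) k = 0.
Proof.
elim: k => // k IHk; rewrite ltnS leq_eqVlt pochhammerS => /orP[/eqP <-|/IHk ->].
  by rewrite addNr mulr0.
by rewrite mul0r.
Qed.

Lemma pochhammer_neq0 (K : idomainType) (c : K) (k : nat) :
  (forall i : nat, c + i%:R != 0) -> pochhammer c k != 0.
Proof. by move=> c_neq0; apply/prodf_neq0 => i _. Qed.

(** The summand vanishes beyond index [n], so the partial sums are eventually constant. Any bound
    [m > n] is allowed, so that series with different [n] can share one range of summation. *)
Lemma hyp3F2_terminating (K : numFieldType) (n m : nat) (c2 c3 d1 d2 z : K) :
  (n < m)%N ->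
  hyp3F2 (- n%:R) c2 c3 d1 d2 z =
  \sum_(k < m) pochhammer (- n%:R) k * pochhammer c2 k * pochhammer c3 k
    / (pochhammer d1 k * pochhammer d2 k) * (z ^+ k / (k`!)%:R).
Proof.
move=> nm; rewrite /hyp3F2; apply: cvg_lim; first exact: norm_hausdorff.
apply: cvg_near_cst; exists m => // p /= mp.
rewrite /series /= (big_cat_nat _ mp) //= big_mkord.
rewrite [X in _ + X = _]big_nat_cond [X in _ + X = _]big1 ?addr0 // => k.
by case/andP=> /andP[mk _] _; rewrite pochhammerN_eq0 ?mul0r // (leq_trans nm).
Qed.

Lemma hyp3F2_contiguous (K : numFieldType) (n : nat) (c2 c3 d1 d2 : K)
    (d1_neq0 : forall k : nat, d1 + k%:R != 0)
    (d2_neq0 : forall k : nat, d2 + k%:R != 0) :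
  (n%:R + 1) * (c2 + c3 - d1 - d2 - n%:R) * hyp3F2 (- n%:R) c2 c3 d1 d2 1
  + (d1 * d2 - c2 * c3
     + (n%:R + 1) * (2 * d1 + 2 * d2 - c2 - c3 + 2 * n%:R + 1))
    * hyp3F2 (- (n + 1)%:R) c2 c3 d1 d2 1
  - (d1 + n%:R + 1) * (d2 + n%:R + 1) * hyp3F2 (- (n + 2)%:R) c2 c3 d1 d2 1
  = 0.
Proof.
have lt0 : (n < n.+3)%N by rewrite ltnS ltnW.
have lt1 : (n + 1 < n.+3)%N by rewrite addn1.
have lt2 : (n + 2 < n.+3)%N by rewrite addn2.
rewrite (hyp3F2_terminating _ _ _ _ _ _ _ _ lt0).
rewrite (hyp3F2_terminating _ _ _ _ _ _ _ _ lt1).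
rewrite (hyp3F2_terminating _ _ _ _ _ _ _ _ lt2).
pose t k : K := pochhammer c2 k * pochhammer c3 k
    / (pochhammer d1 k * pochhammer d2 k) * (1 ^+ k / (k`!)%:R).
(* Of the three symbols, the one with the lowest parameter serves as reference: the other two are
   polynomials in [k] times [P k], up to the nonzero constants [n + 2] and [n + 1]. *)
pose P k : K := pochhammer (- (n + 2)%:R) k.
pose G k : K :=
  k%:R * (d1 + k%:R - 1) * (d2 + k%:R - 1) * t k * P k / (n%:R + 2).
have n1_neq0 : n%:R + 1 != 0 :> K by rewrite natr1 pnatr_eq0.
have n2_neq0 : n%:R + 2 != 0 :> K by rewrite -(natrD K n 2) pnatr_eq0 addn2.
have tS k : t k.+1 * (k%:R + 1) * (d1 + k%:R) * (d2 + k%:R)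
    = t k * (c2 + k%:R) * (c3 + k%:R).
  rewrite /t !expr1n !pochhammerS factS natrM -natr1.
  have k1_neq0 : k%:R + 1 != 0 :> K by rewrite natr1 pnatr_eq0.
  have kf_neq0 : (k`!)%:R != 0 :> K by rewrite pnatr_eq0 -lt0n fact_gt0.
  have p1 := pochhammer_neq0 _ _ k d1_neq0.
  have p2 := pochhammer_neq0 _ _ k d2_neq0.
  have q1 := d1_neq0 k; have q2 := d2_neq0 k.
  by field; rewrite p1 p2 q1 q2 k1_neq0 kf_neq0.
have P1 k : pochhammer (- (n + 1)%:R) k
    = P k * (n%:R + 2 - k%:R) / (n%:R + 2).
  have := pochhammer_subr1 K (- (n + 1)%:R) k.
  rewrite (_ : - (n + 1)%:R - 1 = - (n + 2)%:R); last by rewrite !natrD; ring.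
  rewrite -/(P k) (natrD K n 2); move: (pochhammer _ k) => Q e.
  apply: (mulIf n2_neq0); rewrite mulfVK //.
  by transitivity (- (- (n%:R + 2) * Q)); [ring | rewrite e; ring].
have P0 k : pochhammer (- n%:R) k
    = P k * (n%:R + 2 - k%:R) * (n%:R + 1 - k%:R)
      / ((n%:R + 2) * (n%:R + 1)).
  have := pochhammer_subr1 K (- n%:R) k.
  rewrite (_ : - n%:R - 1 = - (n + 1)%:R); last by rewrite !natrD; ring.
  rewrite P1 (natrD K n 1); move: (pochhammer _ k) => Q e.
  apply: (mulIf n1_neq0); transitivity (- (- (n%:R + 1) * Q)); first by ring.
  by rewrite e; field; rewrite n1_neq0 n2_neq0.
have GS k : G k.+1 - G k =
   (n%:R + 1) * (c2 + c3 - d1 - d2 - n%:R) * (pochhammer (- n%:R) k * t k)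
  + (d1 * d2 - c2 * c3
     + (n%:R + 1) * (2 * d1 + 2 * d2 - c2 - c3 + 2 * n%:R + 1))
    * (pochhammer (- (n + 1)%:R) k * t k)
  - (d1 + n%:R + 1) * (d2 + n%:R + 1) * (P k * t k).
  (* The factors of [G k.+1] are grouped as the left side of [tS]; then all terms are multiples of
     [t k * P k], and a rational identity remains. *)
  have -> : G k.+1 =
      (t k.+1 * (k%:R + 1) * (d1 + k%:R) * (d2 + k%:R))
      * P k * (k%:R - n%:R - 2) / (n%:R + 2).
    rewrite /G /P pochhammerS natrD -natr1; field; exact: n2_neq0.
  rewrite tS P0 P1 /G; field; by rewrite n1_neq0 n2_neq0.
transitivity (\sum_(0 <= k < n.+3) (G k.+1 - G k)).
  rewrite big_mkord !mulr_sumr -sumrN -!big_split /=; apply: eq_bigr => k _.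
  by rewrite GS /t /P !mulrA.
(* Both ends vanish: [G 0] by its factor [k], and [G n.+3] because $(-n-2)_{n+3}=0$. *)
rewrite telescope_sumr // /G !mul0r subr0 /P pochhammerN_eq0 ?addn2 //.
by rewrite mulr0 mul0r.
Qed.

Lemma tail_add_at (V : nmodType) (m : nat) (v : 'I_m -> V) (i : 'I_m) (t : V)
    (j : nat) :
  tail (add_at v i t) j = tail v j + (if (j <= i)%N then t else 0).
Proof.
rewrite /tail; case: ifP => ji.
  rewrite (bigD1 i) //= [in RHS](bigD1 i) //= /add_at eqxx.
  rewrite addrAC; congr (_ + _ + _).
  by apply: eq_bigr => k /andP[_ /negbTE ->].
rewrite addr0; apply: eq_bigr => k jk; rewrite /add_at ifN //.
by apply: contraFneq ji => <-.
Qed.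

Lemma tail0 (V : nmodType) (m : nat) (v : 'I_m.+1 -> V) :
  tail v 0 = v ord0 + tail v 1.
Proof.
rewrite /tail (bigD1 ord0) //=; congr (_ + _).
by apply: eq_bigl => i; rewrite lt0n.
Qed.

Lemma tail0_Ordinal (V : nmodType) (m : nat) (m_gt0 : (0 < m)%N)
    (v : 'I_m -> V) :
  tail v 0 = v (Ordinal m_gt0) + tail v 1.
Proof.
case: m m_gt0 v => // m m_gt0 v.
by rewrite tail0; congr (v _ + _); apply: val_inj.
Qed.

Lemma not_nonpos_integer_neq0 (R : realType) (d : R) (k : nat) :
  ~ nonpos_integer d -> d%:C + k%:R != 0 :> R[i].
Proof.
move=> dP; rewrite -(rmorph_nat (real_complex R)) -rmorphD /=.
rewrite fmorph_eq0 addr_eq0; apply/eqP => dE; apply: dP; by exists k.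
Qed.

Section FirstFactor.
Variables (R : realType) (r : nat) (r_gt0 : (0 < r)%N).
Variables (n : 'I_r -> nat) (a b : 'I_r.+1 -> R) (x : 'I_r -> R[i]).
Let i0 := Ordinal r_gt0.

Definition multiS_factor (n : 'I_r -> nat) (b : 'I_r.+1 -> R) (j : 'I_r) :
    R[i] :=
  pochhammer ((tail a j.+1)%:C + x j / 2) (tail n j.+1) *
  hyp3F2 (- (n j)%:R)
         ((n j)%:R + 2 * (tail n j.+1)%:R + (tail a j)%:C + (tail b j)%:C - 1)
         ((tail n j.+1)%:R + (tail a j.+1)%:C + x j / 2)
         (lower1 n a b j)%:C (lower2 n a j)%:C 1.

(** The part common to the three functions; the Pochhammer symbol of the first factor belongs to it,
    since it involves only $|\mathbf n^2|$, $|\mathbf a^2|$ and $x_1$. *)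
Definition multiS_cofactor : R[i] :=
  pochhammer ((tail a 1)%:C + x i0 / 2) (tail n 1)
  * \prod_(j < r | j != i0) multiS_factor n b j.

(** Only the first upper parameter follows [m]: the second depends on $n_1+b_1$, which the shifts
    preserve, and the others involve neither $n_1$ nor $b_1$. *)
Definition first_hyp3F2 (m : nat) : R[i] :=
  hyp3F2 (- m%:R)
         ((n i0)%:R + 2 * (tail n 1)%:R + (tail a 0)%:C + (tail b 0)%:C - 1)
         ((tail n 1)%:R + (tail a 1)%:C + x i0 / 2)
         (lower1 n a b i0)%:C (lower2 n a i0)%:C 1.

Lemma multiS_prod (n' : 'I_r -> nat) (b' : 'I_r.+1 -> R) :
  multiS n' x a b' = \prod_(j < r) multiS_factor n' b' j.
Proof. by []. Qed.

Lemma multiSE : multiS n x a b = multiS_cofactor * first_hyp3F2 (n i0).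
Proof. by rewrite multiS_prod (bigD1 i0) //= mulrAC. Qed.

Lemma multiS_add_at (s : nat) :
  multiS (add_at n i0 s) x a (add_at b ord0 (- s%:R))
  = multiS_cofactor * first_hyp3F2 (n i0 + s).
Proof.
have tn j : tail (add_at n i0 s) j.+1 = tail n j.+1.
  by rewrite tail_add_at addr0.
have tb j : tail (add_at b ord0 (- s%:R)) j.+1 = tail b j.+1.
  by rewrite tail_add_at addr0.
have tb0 : tail (add_at b ord0 (- s%:R)) 0 = tail b 0 - s%:R.
  by rewrite tail_add_at.
have n0 : add_at n i0 s i0 = (n i0 + s)%N by rewrite /add_at eqxx.
have nS j : j != i0 -> add_at n i0 s j = n j by rewrite /add_at => /negbTE ->.
move: (add_at n i0 s) (add_at b _ _) tn tb tb0 n0 nS => n' b' tn tb tb0 n0 nS.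
have first_factor : multiS_factor n' b' i0
    = pochhammer ((tail a 1)%:C + x i0 / 2) (tail n 1)
      * first_hyp3F2 (n i0 + s).
  rewrite /multiS_factor /lower1 /lower2 !tn !tb tb0 n0.
  rewrite (_ : (n i0 + s)%:R + 2 * (tail n 1)%:R + (tail a 0)%:C
      + (tail b 0 - s%:R)%:C - 1 = (n i0)%:R + 2 * (tail n 1)%:R
      + (tail a 0)%:C + (tail b 0)%:C - 1) //.
  by rewrite natrD rmorphB /= rmorph_nat; ring.
rewrite multiS_prod (bigD1 i0) /=; last by [].
rewrite first_factor (eq_bigr (multiS_factor n b)); first by rewrite mulrAC.
move=> j j_neq0; have j_gt0 : (0 < j)%N.
  by rewrite lt0n; apply: contra_neq j_neq0 => j0; apply: val_inj.
(* The second upper parameter contains the tail from [j] itself, which avoids the shifted component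
   as [j > 0]. *)
have tbj : tail b' j = tail b j by rewrite -(prednK j_gt0) tb.
rewrite /multiS_factor /lower1 /lower2 !tn !tb tbj (nS j j_neq0).
reflexivity.
Qed.

End FirstFactor.

Theorem theorem5p14 (R : realType) (r : nat) (r_gt0 : (0 < r)%N)
    (n : 'I_r -> nat) (a b : 'I_r.+1 -> R) (x : 'I_r -> R[i])
    (n1_ge1 : (1 <= n (Ordinal r_gt0))%N)
    (adm0 : admissible n a b)
    (adm1 : admissible (add_at n (Ordinal r_gt0) 1%N) a (add_at b ord0 (- 1)))
    (adm2 : admissible (add_at n (Ordinal r_gt0) 2%N) a (add_at b ord0 (- 2))) :
  E0 r_gt0 n x b * multiS n x a b
  + E1 r_gt0 n x a b
    * multiS (add_at n (Ordinal r_gt0) 1%N) x a (add_at b ord0 (- 1))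
  + E2 r_gt0 n a b
    * multiS (add_at n (Ordinal r_gt0) 2%N) x a (add_at b ord0 (- 2)) = 0.
Proof.
rewrite (multiSE _ _ r_gt0) (multiS_add_at _ _ r_gt0 n a b x 1).
rewrite (multiS_add_at _ _ r_gt0 n a b x 2).
have [/not_nonpos_integer_neq0 d1P /not_nonpos_integer_neq0 d2P] :=
  adm0 (Ordinal r_gt0).
have := hyp3F2_contiguous _ (n (Ordinal r_gt0))
  ((n (Ordinal r_gt0))%:R + 2 * (tail n 1)%:R
    + (tail a 0)%:C + (tail b 0)%:C - 1)
  ((tail n 1)%:R + (tail a 1)%:C + x (Ordinal r_gt0) / 2)
  _ _ d1P d2P.
rewrite -!/(first_hyp3F2 _ _ r_gt0 n a b x _).
move: (multiS_cofactor _ _ _ _ _ _ _) => C.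
move: (first_hyp3F2 _ _ _ _ _ _ _ (n _)).
move: (first_hyp3F2 _ _ _ _ _ _ _ (n _ + 1)).
move: (first_hyp3F2 _ _ _ _ _ _ _ (n _ + 2)) => F2 F1 F0.
have n_neq0 : (n (Ordinal r_gt0))%:R != 0 :> R[i] by rewrite pnatr_eq0 -lt0n.
have n1_neq0 : (n (Ordinal r_gt0))%:R + 1 != 0 :> R[i].
  by rewrite natr1 pnatr_eq0.
rewrite /lower1 /lower2 /E0 /E1 /E2 !pochhammerS /pochhammer !big_ord0 /=.
(* Splitting off the first components expresses both relations in the same independent
   quantities. *)
rewrite !(tail0_Ordinal _ _ r_gt0 n) !tail0.
rewrite !(rmorphD, rmorphM, rmorph_nat) /=.
move: (n _)%:R n_neq0 n1_neq0 => m m_neq0 m1_neq0 rel.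
(* Multiplying by $(n_1)_2=n_1(n_1+1)$ clears the denominators; the result is the cofactor [C] times
   [rel]. *)
apply: (mulfI (mulf_neq0 m_neq0 m1_neq0)); rewrite mulr0.
rewrite -[RHS](mulr0 C) -rel; field.
by rewrite m_neq0 m1_neq0.
Qed.
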